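(* Let $G_1$ and $G_2$ be two connected graphs, each with $n$ vertices and $m$ edges, having signless Laplacian spectra $0<\mu^+_n\leq\mu^+_{n-1}\leq\cdots\leq\mu^+_1$ and $0<\lambda^+_n\leq\lambda^+_{n-1}\leq\cdots\leq\lambda^+_1$, respectively, with $\mu^+_n>1$ and $\lambda^+_n>1$. Let $p$ be a positive integer such that $$\frac{2m}{p+n}<\min(\mu^+_{n}-1,\lambda^+_{n}-1).$$ Then $LE^+((G_1\cup\overline{K_p})\times K_p)=LE^+((G_2\cup\overline{K_p})\times K_p)$.
   Context: All graphs are finite, undirected and simple. For a graph $G$ with $N$ vertices and $M$ edges, adjacency matrix $A(G)$ and diagonal degree matrix $D(G)$, the signless Laplacian matrix is $L^+(G)=D(G)+A(G)$; its eigenvalues with multiplicity, $\mu^+_1,\dots,\mu^+_N$, form the signless Laplacian spectrum of $G$. The signless Laplacian energy is $LE^+(G)=\sum_{i=1}^{N}\left|\mu^+_i-\frac{2M}{N}\right|$. $K_p$ is the complete graph on $p$ vertices, $\overline{K_p}$ the graph on $p$ vertices with no edges, and $G\cup H$ the disjoint union. $G\times H$ is the Cartesian product: vertex set $V(G)\times V(H)$, with $(u_1,v_1)$ adjacent to $(u_2,v_2)$ iff either $u_1=u_2$ and $v_1v_2\in E(H)$, or $v_1=v_2$ and $u_1u_2\in E(G)$. *)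

(* Defs.v *)
From mathcomp Require Import all_boot all_order all_algebra.

Set Implicit Arguments.
Unset Strict Implicit.
Unset Printing Implicit Defensive.

Import Order.TTheory GRing.Theory Num.Theory.
Local Open Scope ring_scope.

Record sgraph := SGraph {
  vertex :> finType;
  adj : rel vertex;
  adj_sym : symmetric adj;
  adj_irr : irreflexive adj
}.

Definition edges (G : sgraph) : {set {set G}} :=
  [set e | [exists x : G, exists y : G, adj x y && (e == [set x; y])]].

Definition deg (G : sgraph) (x : G) : nat := #|[set y | adj x y]|.

Definition connected (G : sgraph) : Prop :=
  (0 < #|G|)%N /\ forall x y : G, connect (@adj G) x y.

Definition complete_rel (p : nat) : rel 'I_p := fun x y => x != y.

Lemma complete_sym p : symmetric (@complete_rel p).
Proof. by move=> x y; rewrite /complete_rel eq_sym. Qed.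

Lemma complete_irr p : irreflexive (@complete_rel p).
Proof. by move=> x; rewrite /complete_rel eqxx. Qed.

Definition complete (p : nat) : sgraph :=
  SGraph (@complete_sym p) (@complete_irr p).

Definition edgeless_rel (p : nat) : rel 'I_p := fun _ _ => false.

Lemma edgeless_sym p : symmetric (@edgeless_rel p).
Proof. by []. Qed.

Lemma edgeless_irr p : irreflexive (@edgeless_rel p).
Proof. by []. Qed.

Definition edgeless (p : nat) : sgraph :=
  SGraph (@edgeless_sym p) (@edgeless_irr p).

Definition union_rel (G H : sgraph) : rel (G + H)%type := fun x y =>
  match x, y with
  | inl u, inl v => adj u v
  | inr u, inr v => adj u v
  | _, _ => false
  end.

Lemma union_sym (G H : sgraph) : symmetric (@union_rel G H).
Proof. by move=> [x|x] [y|y] //=; rewrite adj_sym. Qed.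

Lemma union_irr (G H : sgraph) : irreflexive (@union_rel G H).
Proof. by move=> [x|x] /=; rewrite adj_irr. Qed.

Definition disjoint_union (G H : sgraph) : sgraph :=
  SGraph (@union_sym G H) (@union_irr G H).

Definition cart_rel (G H : sgraph) : rel (G * H)%type := fun x y =>
  (x.1 == y.1) && adj x.2 y.2 || (x.2 == y.2) && adj x.1 y.1.

Lemma cart_sym (G H : sgraph) : symmetric (@cart_rel G H).
Proof.
move=> x y; rewrite /cart_rel (eq_sym x.1) (eq_sym x.2).
by rewrite (adj_sym x.1) (adj_sym x.2).
Qed.

Lemma cart_irr (G H : sgraph) : irreflexive (@cart_rel G H).
Proof. by move=> x; rewrite /cart_rel !adj_irr !andbF. Qed.

Definition cartesian (G H : sgraph) : sgraph :=
  SGraph (@cart_sym G H) (@cart_irr G H).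

Section SignlessLaplacian.

(* The signless Laplacian is real symmetric, so all its eigenvalues in C are
   real and they are pairwise comparable in the partial order of C. *)
Variables (C : numClosedFieldType) (G : sgraph).

Definition adjacency : 'M[C]_#|G| :=
  \matrix_(i, j) (adj (enum_val i) (enum_val j))%:R.

Definition degree_mx : 'M[C]_#|G| := diag_mx (\row_i (deg (enum_val i))%:R).

Definition signless_laplacian : 'M[C]_#|G| := degree_mx + adjacency.

(* The roots of the characteristic polynomial listed with multiplicity, in an
   unspecified order. *)
Definition signless_spectrum : seq C :=
  sval (closed_field_poly_normal (char_poly signless_laplacian)).

Definition signless_energy : C :=
  \sum_(mu <- signless_spectrum) `|mu - (2 * #|edges G|)%:R / #|G|%:R|.

End SignlessLaplacian.

(* Main.v *)
(* The signless Laplacian of a Cartesian product is a Kronecker sum, and that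
   of a disjoint union is block diagonal; both are symmetric, hence
   diagonalizable.  So the eigenvalues of (G u co-K_p) x K_p are the d + e and
   the e, with d ranging over the spectrum of G and e over that of K_p.  Each e
   is p - 2 or 2p - 2, and the average degree is c = 2m/(p+n) + p - 1, so
   d - 1 >= 2m/(p+n) forces d + e >= c.  The absolute values |d + e - c| can
   then be dropped, and since the d sum to 2m the energy depends on n, m and p
   only. *)
Require Import Defs.
From mathcomp Require Import all_boot all_order all_algebra.
From mathcomp Require Import zify ring.

Set Implicit Arguments.
Unset Strict Implicit.
Unset Printing Implicit Defensive.

Import Order.TTheory GRing.Theory Num.Theory.
Local Open Scope ring_scope.

(** * Diagonalization of the signless Laplacian, its spectrum and its trace *)

Section Eigenbasis.
Variables (C : numClosedFieldType) (G : sgraph).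

Definition signless_entry (x y : G) : C :=
  (deg x)%:R * (x == y)%:R + (adj x y)%:R.

(* The eigenvectors [v x] are indexed by the vertices themselves, so that bases
   of a disjoint union or a Cartesian product are built from bases of the
   factors without renumbering; [w] is the inverse of the base change [v]. *)
Definition eigenbasis (d : G -> C) : Prop :=
  exists v w : G -> G -> C,
    (forall x z, \sum_y v x y * w y z = (x == z)%:R) /\
    (forall x z, \sum_y v x y * signless_entry y z = d x * v x z).

Lemma signless_laplacianE i j :
  signless_laplacian C G i j = signless_entry (enum_val i) (enum_val j).
Proof.
rewrite !mxE /signless_entry (inj_eq enum_val_inj).
by case: eqP => _; rewrite ?mulr1 ?mulr0.
Qed.

Lemma sum_enum_val (F : G -> C) :
  \sum_x F x = \sum_(i < #|G|) F (enum_val i).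
Proof. by rewrite -big_enum_val; apply: eq_bigl. Qed.

(** Passes between vertex indices and matrix indices, so that determinants, traces and the spectral
    theorem apply. *)
Lemma eigenbasisP (d : G -> C) :
  eigenbasis d <-> exists2 P : 'M[C]_#|G|, P \in unitmx &
    P *m signless_laplacian C G = diag_mx (\row_(i < #|G|) d (enum_val i)) *m P.
Proof.
split=> [[v [w [vw vL]]]|[P Pu PL]].
  pose V := \matrix_(i < #|G|, j < #|G|) v (enum_val i) (enum_val j).
  pose W := \matrix_(i < #|G|, j < #|G|) w (enum_val i) (enum_val j).
  have VW : V *m W = 1%:M.
    apply/matrixP => i j; rewrite !mxE -(inj_eq enum_val_inj) -vw sum_enum_val.
    by apply: eq_bigr => k _; rewrite !mxE.
  exists V; first by case: (mulmx1_unit VW).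
  apply/matrixP => i j; rewrite mul_diag_mx !mxE -vL sum_enum_val.
  by apply: eq_bigr => k _; rewrite signless_laplacianE !mxE.
exists (fun x y => P (enum_rank x) (enum_rank y)).
exists (fun x y => invmx P (enum_rank x) (enum_rank y)).
split=> x z; rewrite sum_enum_val.
  have /matrixP/(_ (enum_rank x) (enum_rank z)) := mulmxV Pu.
  rewrite !mxE (inj_eq enum_rank_inj) => <-.
  by apply: eq_bigr => k _; rewrite enum_valK.
have /matrixP/(_ (enum_rank x) (enum_rank z)) := PL.
rewrite mul_diag_mx !mxE enum_rankK => <-.
by apply: eq_bigr => k _; rewrite signless_laplacianE enum_valK enum_rankK.
Qed.

(** The matrix is symmetric with natural entries, which conjugation fixes; it is thus Hermitian,
    hence normal, and the spectral theorem applies. *)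
Lemma eigenbasis_exists : exists d : G -> C, eigenbasis d.
Proof.
have Lsym : signless_laplacian C G \is normalmx.
  apply/hermitian_normalmx/is_hermitianmxP; rewrite expr0 scale1r.
  apply/matrixP => i j; rewrite [RHS]mxE [in RHS]mxE
    !signless_laplacianE /signless_entry.
  rewrite rmorphD rmorphM !rmorph_nat adj_sym eq_sym.
  by case: eqP => [->|_] //; rewrite !mulr0.
have LE := orthomx_spectralP Lsym.
exists (fun x => spectral_diag (signless_laplacian C G) 0 (enum_rank x)).
apply/eigenbasisP; exists (spectralmx (signless_laplacian C G)).
  exact: spectral_unit.
rewrite {2}LE !mulmxA mulmxV ?spectral_unit // mul1mx; congr (diag_mx _ *m _).
by apply/rowP => i; rewrite mxE enum_valK.
Qed.

(** Similar matrices share their characteristic polynomial, and a product of monic linear factors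
    determines its roots up to order. *)
Lemma eigenbasis_spectrum (d : G -> C) :
  eigenbasis d -> perm_eq (signless_spectrum C G) [seq d x | x : G].
Proof.
move=> /eigenbasisP[P Pu PL]; rewrite /signless_spectrum.
case: closed_field_poly_normal => s /=.
rewrite (monicP (char_poly_monic _)) scale1r => sE.
apply: prod_XsubC_eq; rewrite -sE big_image /=.
set D := diag_mx _ in PL.
transitivity (char_poly D); last first.
  rewrite char_poly_trig; last exact/is_diag_mx_is_trig/diag_mx_is_diag.
  rewrite [RHS]big_enum_val; apply: eq_bigr => i _.
  by rewrite !mxE eqxx.
(* [P (X - L) = (X - D) P] over polynomials; the factor [\det P], a nonzero constant, then
   cancels. *)
have : \det (map_mx polyC P *m char_poly_mx (signless_laplacian C G)) =
    \det (char_poly_mx D *m map_mx polyC P).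
  congr (\det _); rewrite /char_poly_mx mulmxBr mulmxBl -!map_mxM PL.
  by rewrite mul_scalar_mx mul_mx_scalar.
rewrite !det_mulmx mulrC => /mulIf; apply.
by rewrite det_map_mx polyC_eq0 -unitfE -unitmxE.
Qed.

Lemma eigenbasis_trace (d : G -> C) :
  eigenbasis d -> \sum_x d x = (\sum_(x : G) deg x)%:R.
Proof.
move=> /eigenbasisP[P Pu PL].
have : \tr (signless_laplacian C G) =
    \tr (diag_mx (\row_(i < #|G|) d (enum_val i))).
  rewrite -(mulKmx Pu (signless_laplacian C G)) PL mxtrace_mulC.
  by rewrite mulmxK.
rewrite mxtrace_diag natr_sum !sum_enum_val => LD.
transitivity (\tr (signless_laplacian C G)).
  by rewrite LD; apply: eq_bigr => i _; rewrite mxE.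
apply: eq_bigr => i _.
by rewrite signless_laplacianE /signless_entry eqxx adj_irr mulr1 addr0.
Qed.

Lemma signless_energyE (d : G -> C) : eigenbasis d ->
  signless_energy C G =
  \sum_x `|d x - (2 * #|edges G|)%:R / #|G|%:R|.
Proof.
move=> dG.
by rewrite /signless_energy (perm_big _ (eigenbasis_spectrum dG)) big_image.
Qed.

End Eigenbasis.

(** * Edge counts, and degrees in unions and products *)

Lemma handshake (G : sgraph) : (2 * #|edges G|)%N = (\sum_(x : G) deg x)%N.
Proof.
have edgesP (e : {set G}) :
    reflect (exists x y, adj x y /\ e = [set x; y]) (e \in edges G).
  rewrite inE; apply: (iffP existsP) => [[x /existsP[y /andP[xy /eqP ->]]]|].
    by exists x, y.
  by case=> x [y [xy ->]]; exists x; apply/existsP; exists y; rewrite xy eqxx.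
(* Double counting of incidences: [y |-> [set x; y]] maps the neighbours of [x] bijectively onto the
   edges containing [x]. *)
have degE (x : G) : deg x = (\sum_(e in edges G) (x \in e))%N.
  rewrite -big_mkcondr sum1_card /=.
  rewrite /deg -(card_in_imset (f := fun y => [set x; y])); last first.
    move=> y z; rewrite !inE => xy xz /setP/(_ y); rewrite !inE eqxx orbT.
    case: eqP xy => [->|_ _]; first by rewrite adj_irr.
    by move/esym/eqP.
  apply: eq_card => e; apply/imsetP/andP => [[y]|[/edgesP[y [z [yz ->]]]]].
    rewrite inE => xy ->; split; last by rewrite !inE eqxx.
    by apply/edgesP; exists x, y.
  rewrite !inE => /orP[]/eqP->; first by exists z; rewrite ?inE.
  by exists y; rewrite ?inE 1?adj_sym // setUC.
under eq_bigr do rewrite degE.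
rewrite exchange_big /= mulnC -sum_nat_const.
apply: eq_bigr => e /edgesP[x [y [xy ->]]].
rewrite -big_mkcond sum1_card cards2.
by case: eqP xy => // ->; rewrite adj_irr.
Qed.

Lemma sum_disjoint_union (V : nmodType) (G H : sgraph)
    (F : disjoint_union G H -> V) :
  \sum_z F z = \sum_x F (inl x) + \sum_y F (inr y).
Proof. exact: big_sumType. Qed.

Lemma sum_cartesian (V : nmodType) (G H : sgraph) (F : cartesian G H -> V) :
  \sum_z F z = \sum_x \sum_a F (x, a).
Proof. by rewrite pair_bigA; apply: eq_bigr => -[]. Qed.

Lemma deg_sum (G : sgraph) (x : G) : deg x = (\sum_y adj x y)%N.
Proof.
by rewrite /deg -sum1_card big_mkcond; apply: eq_bigr => y _; rewrite inE.
Qed.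

Lemma sum_indicatorl (R : pzSemiRingType) (T : finType) (x : T) (F : T -> R) :
  \sum_y (x == y)%:R * F y = F x.
Proof.
rewrite (bigD1 x) //= eqxx mul1r big1 ?addr0 // => y /negPf.
by rewrite eq_sym => ->; rewrite mul0r.
Qed.

Lemma sum_indicatorr (R : pzSemiRingType) (T : finType) (x : T) (F : T -> R) :
  \sum_y F y * (y == x)%:R = F x.
Proof.
rewrite (bigD1 x) //= eqxx mulr1 big1 ?addr0 // => y /negPf ->.
by rewrite mulr0.
Qed.

(** The two alternatives exclude each other by irreflexivity, so the disjunction becomes a sum: the
    Kronecker sum, entrywise. *)
Lemma adj_cartesian (G H : sgraph) (x y : G) (a b : H) :
  adj ((x, a) : cartesian G H) (y, b) =
  ((x == y) * adj a b + (a == b) * adj x y)%N :> nat.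
Proof.
rewrite /= /cart_rel /= !mulnb.
by case: eqP => [->|_]; case: eqP => [->|_]; rewrite ?adj_irr //=;
  case: adj.
Qed.

Lemma deg_cartesian (G H : sgraph) (x : G) (a : H) :
  deg ((x, a) : cartesian G H) = (deg x + deg a)%N.
Proof.
rewrite deg_sum sum_cartesian.
under eq_bigr do under eq_bigr do rewrite adj_cartesian.
under eq_bigr do rewrite big_split -big_distrr /=.
rewrite big_split /= addrC; congr addn; last first.
  rewrite -[RHS](sum_indicatorl x (fun=> deg a)).
  by apply: eq_bigr => y _; rewrite natn deg_sum.
rewrite deg_sum; apply: eq_bigr => y _.
rewrite -[RHS](sum_indicatorl a (fun=> adj x y : nat)).
by apply: eq_bigr => b _; rewrite natn.
Qed.

Lemma deg_disjoint_union_inl (G H : sgraph) (x : G) :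
  deg (inl x : disjoint_union G H) = deg x.
Proof. by rewrite !deg_sum sum_disjoint_union /= [X in _ + X]big1 ?addr0. Qed.

Lemma deg_disjoint_union_inr (G H : sgraph) (y : H) :
  deg (inr y : disjoint_union G H) = deg y.
Proof. by rewrite !deg_sum sum_disjoint_union /= [X in X + _]big1 ?add0r. Qed.

Lemma deg_edgeless p (i : edgeless p) : deg i = 0%N.
Proof. by rewrite deg_sum big1. Qed.

Lemma deg_complete p (i : complete p) : deg i = p.-1.
Proof.
rewrite /deg -[in RHS](card_ord p) -(cardsC1 (i : 'I_p)).
by apply: eq_card => j; rewrite !inE /= /complete_rel eq_sym.
Qed.

(** * Eigenbases of unions, products, edgeless and complete graphs *)

Section Operations.
Variable C : numClosedFieldType.

Definition union_eigenvalue (G H : sgraph) (d : G -> C) (e : H -> C)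
    (z : disjoint_union G H) : C :=
  match z with inl x => d x | inr y => e y end.

Lemma eigenbasis_disjoint_union (G H : sgraph) (d : G -> C) (e : H -> C) :
  eigenbasis d -> eigenbasis e -> eigenbasis (union_eigenvalue d e).
Proof.
move=> [v1 [w1 [vw1 vL1]]] [v2 [w2 [vw2 vL2]]].
pose glue (u1 : G -> G -> C) (u2 : H -> H -> C) (z t : disjoint_union G H) :=
  match z, t with
  | inl x, inl y => u1 x y
  | inr x, inr y => u2 x y
  | _, _ => 0
  end.
have entryE : @signless_entry C (disjoint_union G H) =2
    glue (@signless_entry C G) (@signless_entry C H).
  move=> [x|x] [y|y]; rewrite /signless_entry /= ?mulr0 ?addr0 //.
    by rewrite deg_disjoint_union_inl.
  by rewrite deg_disjoint_union_inr.
(* Block diagonal matrices multiply blockwise. *)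
have glueM u1 u2 t1 t2 z t : \sum_y glue u1 u2 z y * glue t1 t2 y t =
    glue (fun x y => \sum_k u1 x k * t1 k y)
         (fun x y => \sum_k u2 x k * t2 k y) z t.
  rewrite sum_disjoint_union; case: z t => [x|x] [y|y] /=.
  - by rewrite [X in _ + X]big1 ?addr0 // => k _; rewrite mul0r.
  - by rewrite !big1 ?addr0 // => k _; rewrite ?mul0r ?mulr0.
  - by rewrite !big1 ?addr0 // => k _; rewrite ?mul0r ?mulr0.
  by rewrite [X in X + _]big1 ?add0r // => k _; rewrite mul0r.
exists (glue v1 v2), (glue w1 w2); split=> z t.
  by rewrite glueM; case: z t => [x|x] [y|y] /=.
under eq_bigr do rewrite entryE.
by rewrite glueM; case: z t => [x|x] [y|y] /=; rewrite ?mulr0.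
Qed.

Lemma eigenbasis_cartesian (G H : sgraph) (d : G -> C) (e : H -> C) :
  eigenbasis d -> eigenbasis e ->
  eigenbasis (fun z : cartesian G H => d z.1 + e z.2).
Proof.
move=> [v1 [w1 [vw1 vL1]]] [v2 [w2 [vw2 vL2]]].
pose tens (u1 : G -> G -> C) (u2 : H -> H -> C) (z t : cartesian G H) :=
  u1 z.1 t.1 * u2 z.2 t.2.
have entryE (z t : cartesian G H) : signless_entry C z t =
    tens (@signless_entry C G) (fun a b => (a == b)%:R) z t +
    tens (fun x y => (x == y)%:R) (@signless_entry C H) z t.
  case: z t => [x a] [y b].
  rewrite /signless_entry deg_cartesian adj_cartesian /tens /=.
  by rewrite xpair_eqE -mulnb !natrD !natrM; ring.
(* The mixed-product rule for Kronecker products. *)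
have tensM u1 u2 t1 t2 z t : \sum_y tens u1 u2 z y * tens t1 t2 y t =
    tens (fun x y => \sum_k u1 x k * t1 k y)
         (fun x y => \sum_k u2 x k * t2 k y) z t.
  rewrite sum_cartesian /tens big_distrlr /=.
  by apply: eq_bigr => k _; apply: eq_bigr => l _; rewrite mulrACA.
exists (tens v1 v2), (tens w1 w2); split=> z t.
  by rewrite tensM /tens vw1 vw2 -natrM mulnb -xpair_eqE -!surjective_pairing.
under eq_bigr do rewrite entryE mulrDr.
by rewrite big_split /= !tensM /tens vL1 vL2 !sum_indicatorr; ring.
Qed.

Lemma eigenbasis_edgeless p : eigenbasis (fun _ : edgeless p => 0 : C).
Proof.
exists (fun x y => (x == y)%:R), (fun x y => (x == y)%:R).
split=> x z; rewrite sum_indicatorl // /signless_entry deg_edgeless.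
by rewrite !mul0r addr0.
Qed.

(** The matrix is [J + (p - 2) I] with [J] all ones, so an eigenvector either has coordinate sum
    zero or belongs to the eigenvalue [2 (p - 1)]. *)
Lemma complete_eigenvalue p (e : complete p -> C) (a : complete p) :
  eigenbasis e -> e a = p%:R - 2 \/ e a = 2 * (p%:R - 1).
Proof.
move=> [v [w [vw vL]]].
have p_gt0 : (0 < p)%N by case: (p) (a : 'I_p) => // -[].
have p1E : p.-1%:R = p%:R - 1 :> C by rewrite -subn1 natrB.
pose s := \sum_b v a b.
have vaE b : s + (p%:R - 2) * v a b = e a * v a b.
  rewrite -vL /signless_entry.
  under [RHS]eq_bigr => c _.
    have -> : adj c b = ~~ (c == b) by [].
    rewrite deg_complete p1E.
    have -> : (~~ (c == b))%:R = 1 - (c == b)%:R :> C.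
      by case: eqP => _; rewrite ?subrr ?subr0.
    have -> : v a c * ((p%:R - 1) * (c == b)%:R + (1 - (c == b)%:R)) =
      v a c + (p%:R - 2) * (v a c * (c == b)%:R) by ring.
    over.
  by rewrite big_split /= -big_distrr /= sum_indicatorr.
(* Summing [vaE] over [b]: either [s = 0], and [vaE] gives the eigenvalue at a
   nonzero coordinate, or the eigenvalue is [2 (p - 1)]. *)
have se : s * (e a - 2 * (p%:R - 1)) = 0.
  have : \sum_b (s + (p%:R - 2) * v a b) = \sum_b e a * v a b.
    by apply: eq_bigr => b _; apply: vaE.
  rewrite big_split /= -!big_distrr /= -/s sumr_const card_ord -mulr_natr.
  by move=> E; rewrite mulrBr [s * e a]mulrC -E; ring.
have [s0|s0] := eqVneq s 0; last first.
  by right; move/eqP: se; rewrite mulf_eq0 (negPf s0) subr_eq0 => /eqP.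
left; have [b vb|v0] := pickP (fun b => v a b != 0).
  by have := vaE b; rewrite s0 add0r => /(mulIf vb).
(* A zero row [v a] would contradict the invertibility of [v]. *)
have := vw a a; rewrite eqxx big1 => [/esym/eqP|b _]; first by rewrite oner_eq0.
by have /negPn/eqP -> := negbT (v0 b); rewrite mul0r.
Qed.

Lemma average_degree_cartesian_complete (G : sgraph) p
    (n := #|G|) (m := #|edges G|)
    (P := cartesian (disjoint_union G (edgeless p)) (complete p)) :
  (0 < p)%N ->
  (2 * #|edges P|)%:R / #|P|%:R = (2 * m)%:R / (p + n)%:R + (p%:R - 1) :> C.
Proof.
move=> p0.
have -> : #|P| = ((p + n) * p)%N.
  by rewrite card_prod card_sum !card_ord addnC.
(* By the handshake identity: the degrees of [G] recur in [p] copies, and each of the [(p + n) * p]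
   vertices gains [p.-1] from the complete factor. *)
have -> : (2 * #|edges P| = 2 * m * p + (p + n) * p * p.-1)%N.
  rewrite (handshake P) sum_cartesian.
  under eq_bigr do under eq_bigr do rewrite deg_cartesian deg_complete.
  under eq_bigr do rewrite sum_nat_const card_ord.
  rewrite sum_disjoint_union.
  under eq_bigr do rewrite deg_disjoint_union_inl.
  under [X in _ + X]eq_bigr do rewrite deg_disjoint_union_inr deg_edgeless.
  rewrite -!big_distrr /= big_split /= !sum_nat_const !card_ord -/n.
  by rewrite /m handshake; ring.
have pn0 : (p + n)%:R != 0 :> C by rewrite pnatr_eq0 addn_eq0 (gtn_eqF p0).
have p0' : p%:R != 0 :> C by rewrite pnatr_eq0 (gtn_eqF p0).
have -> : p%:R - 1 = p.-1%:R :> C by rewrite -subn1 natrB.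
by rewrite natrD !natrM; field; rewrite -natrD pn0.
Qed.

(** A closed form in which [G] enters only through [n] and [m]. The last term comes from the [p]
    isolated vertices, where the absolute values stay. *)
Lemma signless_energy_cartesian_complete (G : sgraph) p (e : complete p -> C)
    (n := #|G|) (m := #|edges G|)
    (c := (2 * m)%:R / (p + n)%:R + (p%:R - 1)) :
  (0 < p)%N -> eigenbasis e ->
  (forall mu, mu \in signless_spectrum C G ->
     (2 * m)%:R / (p + n)%:R <= mu - 1) ->
  signless_energy C (cartesian (disjoint_union G (edgeless p)) (complete p)) =
  (2 * m)%:R *+ p + (\sum_a (e a - c)) *+ n + (\sum_a `|e a - c|) *+ p.
Proof.
move=> p0 eK muG; have [d dG] := eigenbasis_exists C G.
have eU := eigenbasis_cartesian
  (eigenbasis_disjoint_union dG (eigenbasis_edgeless p)) eK.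
rewrite (signless_energyE eU) average_degree_cartesian_complete // -/n -/m -/c.
rewrite sum_cartesian sum_disjoint_union /=; congr (_ + _); last first.
  under eq_bigr do under eq_bigr do rewrite add0r.
  by rewrite sumr_const card_ord.
have d_ge x : (2 * m)%:R / (p + n)%:R <= d x - 1.
  by apply: muG; rewrite (perm_mem (eigenbasis_spectrum dG)) image_f.
have e_ge a : p%:R - 2 <= e a.
  case: (complete_eigenvalue a eK) => -> //; rewrite -subr_ge0.
  have -> : 2 * (p%:R - 1) - (p%:R - 2) = p%:R :> C by ring.
  exact: ler0n.
transitivity (\sum_x \sum_a (d x + (e a - c))).
  apply: eq_bigr => x _; apply: eq_bigr => a _; rewrite addrA ger0_norm //.
  (* Both brackets are nonnegative, by [d_ge] and [e_ge]. *)
  have -> : d x + e a - c =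
      (d x - 1 - (2 * m)%:R / (p + n)%:R) + (e a - (p%:R - 2)).
    by rewrite /c; ring.
  by rewrite addr_ge0 ?subr_ge0.
under [LHS]eq_bigr do rewrite big_split sumr_const card_ord /=.
by rewrite big_split /= sumr_const sumrMnl (eigenbasis_trace dG) -handshake.
Qed.

(** The list is nonincreasing of length [#|G|], so its least entry sits at index [#|G|.-1]. *)
Lemma spectrum_ge_last (G : sgraph) (mu : seq C) (x : C) :
  perm_eq mu (signless_spectrum C G) -> sorted >=%R mu ->
  x \in signless_spectrum C G -> mu`_(#|G|.-1) <= x.
Proof.
move=> mu_spec mu_sorted; rewrite -(perm_mem mu_spec) => /(nthP 0)[i lt_i <-].
have [d dG] := eigenbasis_exists C G.
have szmu : size mu = #|G|.
  by rewrite (perm_size mu_spec) (perm_size (eigenbasis_spectrum dG)) size_image.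
move: (lt_i); rewrite szmu => ltG.
apply: (sorted_leq_nth ge_trans (@lexx _ C) 0 mu_sorted);
  rewrite ?inE ?szmu; lia.
Qed.

End Operations.

Theorem theorem4p2 (C : numClosedFieldType) (G1 G2 : sgraph) (n m : nat)
    (connG1 : connected G1) (connG2 : connected G2)
    (nG1 : #|G1| = n) (nG2 : #|G2| = n)
    (mG1 : #|edges G1| = m) (mG2 : #|edges G2| = m)
    (mu lambda : seq C)
    (mu_spec : perm_eq mu (signless_spectrum C G1))
    (lambda_spec : perm_eq lambda (signless_spectrum C G2))
    (mu_sorted : sorted >=%R mu) (lambda_sorted : sorted >=%R lambda)
    (mu_gt0 : 0 < mu`_n.-1) (lambda_gt0 : 0 < lambda`_n.-1)
    (mu_gt1 : 1 < mu`_n.-1) (lambda_gt1 : 1 < lambda`_n.-1)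
    (p : nat) (p_gt0 : (0 < p)%N)
    (hp : (2 * m)%:R / (p + n)%:R < Num.min (mu`_n.-1 - 1) (lambda`_n.-1 - 1)) :
  signless_energy C (cartesian (disjoint_union G1 (edgeless p)) (complete p)) =
  signless_energy C (cartesian (disjoint_union G2 (edgeless p)) (complete p)).
Proof.
(* The order of [C] is partial: a bound by the minimum splits into two only for comparable elements,
   and positive ones are real. *)
have mu1_real : mu`_n.-1 - 1 \is Num.real by rewrite gtr0_real ?subr_gt0.
have lambda1_real : lambda`_n.-1 - 1 \is Num.real by rewrite gtr0_real ?subr_gt0.
move: hp; rewrite (comparable_lt_min _ (real_comparable mu1_real lambda1_real)).
case/andP=> /ltW mu_ge /ltW lambda_ge.
(* One choice of [e] serves both graphs, so the two closed forms coincide. *)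
have [e eK] := eigenbasis_exists C (complete p).
rewrite !(signless_energy_cartesian_complete p_gt0 eK) ?nG1 ?nG2 ?mG1 ?mG2 //.
  move=> x xG; apply: le_trans lambda_ge _; rewrite lerD2r -nG2.
  exact: spectrum_ge_last xG.
move=> x xG; apply: le_trans mu_ge _; rewrite lerD2r -nG1.
exact: spectrum_ge_last xG.
Qed.
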